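(* There is an absolute constant $c>0$ such that for every $d\ge 2$ the following holds. Let $U=\{x\in\mathbb{R}^d : |x|=1\}$, and let $P$ be any path in $\mathbb{R}^d$ (a continuous curve of finite length $|P|$) starting at the origin that views all of $U$, i.e., every $q\in U$ is visible from some point of $P$. Then \[|P|\ge c\,\frac{d^{3/2}}{\sqrt{\log d}}.\]
   Context: $\log$ is the natural logarithm; $|\cdot|$ is the Euclidean norm. A point $p\in\mathbb{R}^d$ with $|p|\ge 1$ views a point $q\in U$ if the segment $\overline{pq}$ intersects $U$ only at $q$ (equivalently $\langle p,q\rangle\ge 1$); points $p$ with $|p|<1$ view no point of $U$. *)

(* Defs.v *)
From mathcomp Require Import all_boot all_order all_algebra.
From mathcomp Require Import all_classical all_reals all_analysis.

Set Implicit Arguments.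
Unset Strict Implicit.
Unset Printing Implicit Defensive.
Import Order.TTheory GRing.Theory Num.Theory.

Local Open Scope classical_set_scope.
Local Open Scope ring_scope.

(* The library norm on 'rV[R]_d is the sup norm, hence this definition. *)
Definition enorm (R : realType) (d : nat) (u : 'rV[R]_d) : R :=
  Num.sqrt (\sum_(i < d) u 0 i ^+ 2).

Definition unit_sphere (R : realType) (d : nat) : set 'rV[R]_d :=
  [set x | enorm x = 1].
Arguments unit_sphere : clear implicits.

Definition segment (R : realType) (d : nat) (p q : 'rV[R]_d) : set 'rV[R]_d :=
  [set (1 - t) *: p + t *: q | t in `[0, 1]].

Definition views (R : realType) (d : nat) (p q : 'rV[R]_d) : Prop :=
  [/\ 1 <= enorm p, unit_sphere R d q &
      segment p q `&` unit_sphere R d = [set q]].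

(* Same indexing of the partition a < s_0 < ... = b as numfun's variation. *)
Definition polygonal_length (R : realType) (d : nat) (a b : R)
    (f : R -> 'rV[R]_d) (s : seq R) : R :=
  let F := f \o nth b (a :: s) in
  \sum_(0 <= n < size s) enorm (F n.+1 - F n).

Definition curve_length (R : realType) (d : nat) (a b : R)
    (f : R -> 'rV[R]_d) : \bar R :=
  ereal_sup [set (polygonal_length a b f s)%:E | s in itv_partition a b].

(* Main.v *)
Require Import Defs.
From mathcomp Require Import all_boot all_order all_algebra.
From mathcomp Require Import all_classical all_reals all_analysis.
From mathcomp Require Import ring lra zify.
Import Order.TTheory GRing.Theory Num.Theory.
Import numFieldNormedType.Exports.
Local Open Scope classical_set_scope.
Local Open Scope ring_scope.

Set Implicit Arguments.
Unset Strict Implicit.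
Unset Printing Implicit Defensive.

(** If [p] views [q] then [<p, q> >= 1], so it suffices to find a unit vector
    [q] with [<P t, q> < 1] for all [t].  A curve shorter than [N * rho] has a
    [rho]-net of [N] points.  Take a coarse net with [d/2] points and radius
    [l], of order [sqrt (d / ln d)], and restrict [q] to the orthogonal
    complement [W] of that net, of dimension [m >= d/2]: projected to [W], the
    whole curve has norm at most [l].  Take also a fine net of [d^2] points and
    radius [1/2].  Let [q] be the normalised sum, with random signs, of an
    orthonormal basis of [W].  By Hoeffding's inequality each fine net point
    satisfies [<y, q> >= 1/2] with probability at most
    [exp (- m / (32 l^2)) <= d^-4], so a union bound yields [q] with
    [<y, q> < 1/2] on the fine net, hence [<P t, q> < 1] on the curve. *)

(** * Euclidean inner product and visibility *)

Section Dot.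
Context {R : realType}.

Definition dot {d : nat} (u v : 'rV[R]_d) : R := (u *m v^T) 0 0.

Lemma dotE d (u v : 'rV[R]_d) : dot u v = \sum_i u 0 i * v 0 i.
Proof. by rewrite /dot mxE; apply: eq_bigr => i _; rewrite mxE. Qed.

Lemma dotC d (u v : 'rV[R]_d) : dot u v = dot v u.
Proof. by rewrite !dotE; apply: eq_bigr => i _; rewrite mulrC. Qed.

Lemma dotDl d (u v w : 'rV[R]_d) : dot (u + v) w = dot u w + dot v w.
Proof. by rewrite /dot mulmxDl mxE. Qed.

Lemma dotZl d (c : R) (u v : 'rV[R]_d) : dot (c *: u) v = c * dot u v.
Proof. by rewrite /dot -scalemxAl mxE. Qed.

Lemma dotBl d (u v w : 'rV[R]_d) : dot (u - v) w = dot u w - dot v w.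
Proof. by rewrite dotDl -scaleN1r dotZl mulN1r. Qed.

Lemma dotDr d (u v w : 'rV[R]_d) : dot u (v + w) = dot u v + dot u w.
Proof. by rewrite !(dotC u) dotDl. Qed.

Lemma dotZr d (c : R) (u v : 'rV[R]_d) : dot u (c *: v) = c * dot u v.
Proof. by rewrite !(dotC u) dotZl. Qed.

Lemma dotBr d (u v w : 'rV[R]_d) : dot u (v - w) = dot u v - dot u w.
Proof. by rewrite !(dotC u) dotBl. Qed.

Lemma dot_mulmxr d m (u : 'rV[R]_d) (v : 'rV[R]_m) (B : 'M[R]_(m, d)) :
  dot u (v *m B) = dot (u *m B^T) v.
Proof. by rewrite /dot trmx_mul mulmxA. Qed.

Lemma dotvv_ge0 d (u : 'rV[R]_d) : 0 <= dot u u.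
Proof. by rewrite dotE; apply: sumr_ge0 => i _; rewrite -expr2 sqr_ge0. Qed.

Lemma dotvv_eq0 d (u : 'rV[R]_d) : (dot u u == 0) = (u == 0).
Proof.
apply/idP/idP => [|/eqP->]; last by rewrite /dot mul0mx mxE.
rewrite dotE psumr_eq0 => [/allP u0|i _]; last by rewrite -expr2 sqr_ge0.
apply/eqP/rowP => i; rewrite mxE; apply/eqP.
by have := u0 i (mem_index_enum i); rewrite mulf_eq0 orbb.
Qed.

Lemma dotvv_gt0 d (u : 'rV[R]_d) : (0 < dot u u) = (u != 0).
Proof. by rewrite lt_def dotvv_ge0 andbT dotvv_eq0. Qed.

Lemma enormE d (u : 'rV[R]_d) : enorm u = Num.sqrt (dot u u).
Proof. by rewrite /enorm dotE; congr Num.sqrt; apply: eq_bigr => i _. Qed.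

Lemma enorm_ge0 d (u : 'rV[R]_d) : 0 <= enorm u.
Proof. exact: sqrtr_ge0. Qed.

Lemma enorm_sqr d (u : 'rV[R]_d) : enorm u ^+ 2 = dot u u.
Proof. by rewrite enormE sqr_sqrtr// dotvv_ge0. Qed.

Lemma enormB d (u v : 'rV[R]_d) : enorm (u - v) = enorm (v - u).
Proof.
by rewrite !enormE -[u - v]opprB -scaleN1r dotZl dotZr !mulN1r opprK.
Qed.

Lemma unit_sphereE d (u : 'rV[R]_d) : unit_sphere R d u <-> dot u u = 1.
Proof.
rewrite /unit_sphere/= -enorm_sqr; split => [->|/eqP]; first by rewrite expr1n.
by rewrite sqrf_eq1 => /orP[/eqP//|/eqP u1]; have := enorm_ge0 u; rewrite u1; lra.
Qed.

(* AM-GM form of the Cauchy-Schwarz inequality, which avoids square roots. *)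
Lemma dot_le_amgm d (u v : 'rV[R]_d) : dot u v <= dot u u + dot v v / 4.
Proof.
have := dotvv_ge0 (u - 2^-1 *: v).
by rewrite dotBl !dotBr !(dotZl, dotZr) (dotC v u); lra.
Qed.

(** If [dot p q < 1], the line through [p] and [q] meets the sphere again at [q + s *: (p - q)] with
    [0 < s], and [1 <= enorm p] forces [s <= 1]. The segment then contains a second point of the
    sphere. *)
Lemma views_dot_ge1 d (p q : 'rV[R]_d) : views p q -> 1 <= dot p q.
Proof.
move=> [p1 /unit_sphereE qq1 segE]; rewrite leNgt; apply/negP => pq1.
have pp1 : 1 <= dot p p by rewrite -enorm_sqr -[leLHS](expr1n _ 2) lerXn2r// nnegrE ?enorm_ge0.
set D := dot (p - q) (p - q).
have DE : D = dot p p - 2 * dot p q + 1.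
  by rewrite /D dotBl !dotBr qq1 (dotC q p); ring.
have D0 : 0 < D by rewrite DE; lra.
(* the second intersection of the line through [p] and [q] with the sphere *)
pose s := 2 * (1 - dot p q) / D.
have s0 : 0 < s by rewrite divr_gt0//; lra.
have s1 : s <= 1 by rewrite ler_pdivrMr// DE; lra.
have xq : (1 - (1 - s)) *: p + (1 - s) *: q = q + s *: (p - q).
  by apply/rowP => i; rewrite !mxE; ring.
have : (segment p q `&` unit_sphere R d) (q + s *: (p - q)).
  split; first by exists (1 - s) => //=; rewrite in_itv/=; apply/andP; split; lra.
  apply/unit_sphereE; rewrite dotDl !dotDr !(dotZl, dotZr) -/D qq1.
  rewrite (dotC (p - q) q) dotBr qq1 (dotC q p).
  have sD : s * D = 2 * (1 - dot p q) by rewrite divfK// gt_eqF.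
  by rewrite sD; ring.
rewrite segE /= => /eqP; rewrite -subr_eq0 addrC addKr scaler_eq0 (gt_eqF s0)/=.
by rewrite -dotvv_eq0 -/D gt_eqF.
Qed.

End Dot.

(** * Orthonormal families in an orthogonal complement *)

Section Orthonormal.
Context {R : realType}.

Lemma unit_orthogonal_exists k d (A : 'M[R]_(k, d)) : (k < d)%N ->
  exists2 w : 'rV[R]_d, dot w w = 1 & A *m w^T = 0.
Proof.
move=> kd.
have : kermx A^T != 0.
  rewrite kermx_eq0 /row_free mxrank_tr neq_ltn.
  by rewrite (leq_ltn_trans (rank_leq_row A) kd).
case/rowV0Pn => v /sub_kermxP vA v0.
have vv0 : 0 < dot v v by rewrite dotvv_gt0.
exists ((Num.sqrt (dot v v))^-1 *: v).
  rewrite dotZl dotZr mulrA -expr2 exprVn sqr_sqrtr ?ltW// mulVf// gt_eqF//.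
by rewrite linearZ/= -scalemxAr -[A]trmxK -trmx_mul vA trmx0 scaler0.
Qed.

(** Gram-Schmidt is avoided: each new unit vector is appended to the constraint matrix [A], so the
    rows found later are orthogonal to it as well. *)
Lemma orthonormal_exists k d m (A : 'M[R]_(k, d)) : (k + m <= d)%N ->
  exists2 B : 'M[R]_(m, d), B *m B^T = 1%:M & A *m B^T = 0.
Proof.
elim: m k A => [|m IHm] k A kmd.
  by exists 0; [apply/matrixP => -[]|apply/matrixP => ? []].
have [] := @unit_orthogonal_exists k d A.
  by apply: leq_trans kmd; rewrite addnS ltnS leq_addr.
move=> w ww1 Aw.
have [] := IHm _ (col_mx w A); first by rewrite add1n addSn -addnS.
move=> B BB; rewrite mul_col_mx -col_mx0 => /eq_col_mx[wB AB].
rewrite -[m.+1]/(1 + m)%N; exists (col_mx w B).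
  rewrite tr_col_mx mul_col_row BB wB -[B *m w^T]trmxK trmx_mul trmxK wB trmx0.
  rewrite (_ : w *m w^T = 1%:M) -?scalar_mx_block//.
  by apply/matrixP => i j; rewrite !ord1 [RHS]mxE -ww1.
by rewrite tr_col_mx mul_mx_row Aw AB row_mx0.
Qed.

(** Expand the squared norm of the residual [v - v *m B^T *m B], which is nonnegative. *)
Lemma bessel d m (B : 'M[R]_(m, d)) (v : 'rV[R]_d) : B *m B^T = 1%:M ->
  dot (v *m B^T) (v *m B^T) <= dot v v.
Proof.
move=> BB; have := dotvv_ge0 (v - v *m B^T *m B).
rewrite dotBl !dotBr (dotC (_ *m B) v) !dot_mulmxr -(mulmxA _ B) BB mulmx1.
lra.
Qed.

End Orthonormal.

(** * Exponential moments of random sign vectors *)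

Section Signs.
Context {R : realType}.

(* For [x ^+ 2 < 1/2] average [expR x <= 1 / (1 - x)] and its mirror image;
   otherwise [`|x| <= 2 * x ^+ 2] already suffices. *)
Lemma expRD_expRN_le (x : R) :
  expR x + expR (- x) <= 2 * expR (2 * x ^+ 2).
Proof.
have [x2|x2] := ltP (x ^+ 2) (2^-1); last first.
  have xle : x <= 2 * x ^+ 2 by nra.
  have Nxle : - x <= 2 * x ^+ 2 by nra.
  by move: xle Nxle; rewrite -(ler_expR x) -(ler_expR (- x)); lra.
have xx : 0 < 1 - x ^+ 2 by lra.
have [x1 xN1] : 0 < 1 - x /\ 0 < 1 + x by split; nra.
have inv_le y : 0 < 1 - y -> expR y <= (1 - y)^-1 :> R.
  move=> y1; rewrite -[expR y]invrK -expRN lef_pV2 ?posrE ?expR_gt0//.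
  by have := expR_ge1Dx (- y).
have le1 := inv_le _ x1.
have /inv_le le2 : 0 < 1 - - x by lra.
have e : (1 - x)^-1 + (1 - - x)^-1 = 2 * (1 - x ^+ 2)^-1.
  by field; rewrite ?gt_eqF// ?opprK; nra.
have le3 : (1 - x ^+ 2)^-1 <= 1 + 2 * x ^+ 2.
  by rewrite -[leLHS]mul1r ler_pdivrMr//; nra.
by have := expR_ge1Dx (2 * x ^+ 2); lra.
Qed.

Definition sign_row {m} (e : {ffun 'I_m -> bool}) : 'rV[R]_m :=
  \row_i (-1) ^+ e i.

Lemma dot_sign_row m (e : {ffun 'I_m -> bool}) :
  dot (sign_row e) (sign_row e) = m%:R.
Proof.
rewrite dotE (eq_bigr (fun=> 1)) => [|i _].
  by rewrite sumr_const card_ord.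
by rewrite !mxE -expr2 sqrr_sign.
Qed.

(** The unnormalised moment generating function of a random signed sum. By independence it factors
    over the coordinates, and each factor is bounded by [expRD_expRN_le]. *)
Lemma sum_expR_dot_sign_row m (v : 'rV[R]_m) :
  \sum_(e : {ffun 'I_m -> bool}) expR (dot v (sign_row e))
    <= 2 ^+ m * expR (2 * dot v v).
Proof.
under eq_bigr => e _ do rewrite dotE expR_sum.
under eq_bigr => e _ do under eq_bigr => i _ do rewrite mxE.
rewrite -(bigA_distr_bigA (fun i (b : bool) => expR (v 0 i * (-1) ^+ b))).
rewrite dotE mulr_sumr expR_sum -[m in 2 ^+ m]card_ord -prodr_const -big_split/=.
apply: ler_prod => i _; rewrite big_bool/= expr1 expr0 mulrN !mulr1.
by rewrite addr_ge0 ?expR_ge0//= addrC -expr2 expRD_expRN_le.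
Qed.

(** Chernoff and union bound by counting: on average over [e], the sum [Z e] is below
    [expR (l * s)], so some [e] achieves this. All terms of [Z e] being nonnegative, each one is
    then below [expR (l * s)]. *)
Lemma sign_row_exists m (S : seq 'rV[R]_m) (r s : R) :
  0 < r -> 0 <= s ->
  (forall v, v \in S -> dot v v <= r ^+ 2) ->
  (size S)%:R * expR (- (s ^+ 2 / (8 * r ^+ 2))) < 1 ->
  exists e, forall v, v \in S -> dot v (sign_row e) < s.
Proof.
move=> r0 s0 Sr small.
(* minimises [2 * (l * r) ^+ 2 - l * s] *)
pose l := s / (4 * r ^+ 2).
have l0 : 0 <= l by rewrite divr_ge0// mulr_ge0// sqr_ge0.
pose Z (e : {ffun 'I_m -> bool}) := \sum_(v <- S) expR (l * dot v (sign_row e)).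
have Zsum : \sum_e Z e < \sum_(e : {ffun 'I_m -> bool}) expR (l * s).
  rewrite exchange_big/= sumr_const card_ffun card_bool card_ord -mulr_natl natrX.
  apply: (@le_lt_trans _ _ (\sum_(v <- S) 2 ^+ m * expR (2 * (l * r) ^+ 2))).
    rewrite !big_seq; apply: ler_sum => v vS.
    under eq_bigr => e _ do rewrite -dotZl.
    apply: le_trans (sum_expR_dot_sign_row _) _.
    rewrite ler_pM2l ?exprn_gt0// ler_expR ler_pM2l//.
    by rewrite dotZl dotZr mulrA -expr2 [(l * r) ^+ 2]exprMn ler_wpM2l ?sqr_ge0 ?Sr.
  rewrite big_const_seq count_predT iter_addr_0 -[_ *+ size S]mulr_natl mulrCA.
  rewrite ltr_pM2l ?exprn_gt0// -[ltRHS]mul1r -ltr_pdivrMr ?expR_gt0//.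
  rewrite -mulrA -expRN -expRD; congr (_ * expR _ < _): small.
  by rewrite /l; field; rewrite gt_eqF.
have [e Ze] : exists e, Z e < expR (l * s).
  apply/not_existsP => Zge; move: Zsum; rewrite ltNge => /negP; apply.
  by apply: ler_sum => e _; rewrite leNgt; apply/negP/Zge.
exists e => v vS; rewrite ltNge; apply/negP => sv.
move: Ze; rewrite ltNge => /negP; apply.
rewrite /Z (big_rem _ vS)/= -[leLHS]addr0 lerD//; last first.
  by apply: sumr_ge0 => ? _; exact: expR_ge0.
by rewrite ler_expR ler_wpM2l.
Qed.

End Signs.

(** * Finite nets on curves of bounded length *)

Section CurveNet.
Context {R : realType} {d : nat}.
Implicit Types (a b : R) (P : R -> 'rV[R]_d) (s : seq R).

(** A recursive form of [polygonal_length] with a variable starting time, suited to induction on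
    [s]. *)
Fixpoint chain_length P (x : R) s : R :=
  if s is y :: s' then enorm (P y - P x) + chain_length P y s' else 0.

Lemma polygonal_lengthE a b P s :
  polygonal_length a b P s = chain_length P a s.
Proof.
rewrite /polygonal_length; elim: s a => [|y s IHs] a /=.
  by rewrite big_geq.
rewrite big_nat_recl//= -IHs; congr +%R.
Qed.

Lemma chain_length_le_rcons P x s y :
  chain_length P x s <= chain_length P x (rcons s y).
Proof.
elim: s x => [|z s IHs] x /=; first by rewrite addr0 enorm_ge0.
by rewrite lerD2l.
Qed.

Lemma chain_length_le_curve_length a b P s :
  path <%R a s -> last a s <= b ->
  ((chain_length P a s)%:E <= curve_length a b P)%E.
Proof.
move=> as_ sb; have partition_le t : itv_partition a b t ->
    ((chain_length P a t)%:E <= curve_length a b P)%E.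
  by move=> abt; apply: ereal_sup_ubound; exists t; rewrite ?polygonal_lengthE.
have [sbE|sb'] := eqVneq (last a s) b; first by apply: partition_le; split; rewrite ?sbE.
(* A chain that stops before [b] is completed to a partition, which cannot shorten it. *)
apply: (@le_trans _ _ (chain_length P a (rcons s b))%:E).
  by rewrite lee_fin chain_length_le_rcons.
by apply: partition_le; split; rewrite ?last_rcons// rcons_path as_ lt_neqAle sb'.
Qed.

Definition separated P (rho : R) s :=
  {in s &, forall x y, x != y -> rho < enorm (P x - P y)}.

Lemma separated_chain_length P rho x s :
  path <%R x s -> separated P rho (x :: s) ->
  rho *+ size s <= chain_length P x s.
Proof.
elim: s x => [|y s IHs] x //= /andP[xy ys] sep.
rewrite mulrS lerD//.
  by rewrite ltW// sep ?inE ?eqxx ?orbT// gt_eqF.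
by apply: IHs => // u v us vs; apply: sep; rewrite inE (us, vs) orbT.
Qed.

Lemma separated_size_curve_length a b P rho s :
  (0 < size s)%N -> uniq s -> (forall u, u \in s -> a <= u <= b) -> separated P rho s ->
  ((rho *+ (size s).-1)%:E <= curve_length a b P)%E.
Proof.
move=> s0 us sab sep.
(* Put the times in increasing order: consecutive ones then bound [(size s).-1] disjoint pieces of
   the curve, each longer than [rho]. *)
have := sort_lt_sorted s; rewrite us.
move: s0; rewrite -(size_sort <=%R s); have ms := mem_sort <=%R s.
case: (sort <=%R s) ms => [|x t] ms //= _ xt.
have sep' : separated P rho (x :: t).
  by move=> u v; rewrite !ms; exact: sep.
have tab u : u \in x :: t -> a <= u <= b.
  by rewrite ms => /sab.
apply: (@le_trans _ _ (chain_length P x t)%:E).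
  by rewrite lee_fin separated_chain_length.
have lb : last x t <= b by case/andP: (tab _ (mem_last x t)).
have /tab/andP[ax _] : x \in x :: t by rewrite inE eqxx.
(* Partitions increase strictly from [a], so [a] may be prepended only if it differs from the first
   time. *)
have [ax'|ax'] := eqVneq a x; first by subst x; exact: chain_length_le_curve_length.
apply: (@le_trans _ _ (chain_length P a (x :: t))%:E).
  by rewrite lee_fin/= lerDr enorm_ge0.
by apply: chain_length_le_curve_length => //=; rewrite lt_neqAle ax' ax.
Qed.

(* A maximal [rho]-separated set of times is a [rho]-net. *)
Lemma curve_net a b P rho N : 0 < rho ->
  (curve_length a b P < (rho *+ N)%:E)%E ->
  exists s, [/\ (size s <= N)%N, (forall u, u \in s -> a <= u <= b) &
    forall t, a <= t <= b -> exists2 u, u \in s & enorm (P t - P u) <= rho].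
Proof.
move=> rho0 PN; apply: contrapT => nonet.
(* Without a net of at most [N] points, a separated family of size at most [N] always misses some
   time, which extends it. The resulting [N.+1] times have [N] gaps, too many for the length. *)
have sepn n : (n <= N.+1)%N -> exists s,
    [/\ size s = n, uniq s, (forall u, u \in s -> a <= u <= b) & separated P rho s].
  elim: n => [|n IHn] nN; first by exists [::].
  have [s [sn us sab sep]] := IHn (ltnW nN).
  have [t tab tfar] : exists2 t, a <= t <= b &
      forall u, u \in s -> rho < enorm (P t - P u).
    apply: contrapT => notfar; apply: nonet; exists s; split => //; first by rewrite sn.
    move=> t tab; apply: contrapT => tnear; apply: notfar; exists t => // u us'.
    by rewrite ltNge; apply/negP => tu; apply: tnear; exists u.
  exists (t :: s); split => /=.
  - by rewrite sn.
  - rewrite us andbT; apply/negP => /tfar.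
    by rewrite subrr enormE /dot mul0mx mxE sqrtr0 ltNge ltW.
  - by move=> u; rewrite inE => /orP[/eqP->//|/sab].
  - move=> u v; rewrite !inE => /orP[/eqP->|us'] /orP[/eqP->|vs]; rewrite ?eqxx//.
    + by move=> _; exact: tfar.
    + by move=> _; rewrite enormB; exact: tfar.
    + exact: sep.
have [s [sN us sab sep]] := sepn _ (leqnn _).
have := separated_size_curve_length _ us sab sep.
by rewrite sN => /(_ isT)/=; rewrite leNgt PN.
Qed.

End CurveNet.

(** * A unit vector nearly orthogonal to, or pointing away from, a finite set *)

Section UnseenDirection.
Context {R : realType} {d : nat}.

(* The rows of [B] span the orthogonal complement of [K]; in it every point of
   [Y] has norm at most [r], and [q] is a random vertex of a cube. *)
Lemma unseen_direction (K Y : seq 'rV[R]_d) (m : nat) (r : R) :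
  (0 < m)%N -> (size K + m <= d)%N -> 0 < r ->
  (forall y, y \in Y -> exists2 x, x \in K & enorm (y - x) <= r) ->
  (size Y)%:R * expR (- (m%:R / (32 * r ^+ 2))) < 1 ->
  exists2 q : 'rV[R]_d, dot q q = 1 & forall y, y \in Y -> dot y q < 2^-1.
Proof.
move=> m0 Kmd r0 Yr small.
pose A := \matrix_(i < size K) nth 0 K i.
have [B BB AB] := orthonormal_exists A Kmd.
have KB x : x \in K -> x *m B^T = 0.
  move=> xK; have xlt : (index x K < size K)%N by rewrite index_mem.
  have <- : row (Ordinal xlt) A = x by rewrite rowK/= nth_index.
  by rewrite -row_mul AB row0.
have sm0 : 0 < Num.sqrt m%:R :> R by rewrite sqrtr_gt0 ltr0n.
have smE : Num.sqrt m%:R ^+ 2 = m%:R :> R by rewrite sqr_sqrtr.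
(* Sign vectors have norm [Num.sqrt m%:R], so this threshold becomes [2^-1] after normalisation. *)
have [||y||e eY] := @sign_row_exists R m [seq y *m B^T | y <- Y] r (Num.sqrt m%:R / 2).
- exact: r0.
- by rewrite divr_ge0// ltW.
- case/mapP => x xY ->; have [z zK xz] := Yr _ xY.
  (* The projection kills [z], so [x] has the same coordinates as the short vector [x - z]. *)
  rewrite -[x](subrK z) mulmxDl (KB z)// addr0.
  apply: le_trans (bessel _ BB) _; rewrite -enorm_sqr.
  by rewrite lerXn2r// nnegrE ?enorm_ge0// ltW.
- rewrite size_map; congr (_ * expR (- _) < _): small.
  by rewrite exprMn smE; field; rewrite gt_eqF.
pose q := (Num.sqrt m%:R)^-1 *: (sign_row e *m B) : 'rV[R]_d.
have dotq y : dot y q = (Num.sqrt m%:R)^-1 * dot (y *m B^T) (sign_row e).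
  by rewrite dotZr dot_mulmxr.
exists q.
  rewrite dotq -scalemxAl -mulmxA BB mulmx1 dotZl dot_sign_row mulrA -expr2.
  by rewrite exprVn smE mulVf// pnatr_eq0 -lt0n.
move=> y yY; rewrite dotq mulrC ltr_pdivrMr// mulrC.
by apply: eY; exact: map_f.
Qed.

End UnseenDirection.

(** * Estimates behind the two net sizes and the constant *)

Section Numerics.
Context {R : realType}.

(** Here 48 is 3 * 16: the 3 comes from [d <= 3 * d./2], and 16 makes the tail exponent at least
    [4 * ln d%:R]. *)
Definition length_bound (d : nat) : R :=
  48^-1 * (d%:R `^ (3 / 2) / Num.sqrt (ln d%:R)).

Lemma ln_nat_ge_half (d : nat) : (2 <= d)%N -> 2^-1 <= ln d%:R :> R.
Proof.
move=> d2; have D2 : 2 <= d%:R :> R by rewrite ler_nat.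
have := expR_ge1Dx (- ln d%:R : R); rewrite expRN lnK ?posrE; last by lra.
suff : d%:R^-1 <= 2^-1 :> R by lra.
by rewrite lef_pV2 ?posrE//; lra.
Qed.

Lemma length_boundE (d : nat) :
  length_bound d = Num.sqrt d%:R ^+ 3 / (48 * Num.sqrt (ln d%:R)).
Proof.
rewrite /length_bound; have -> : 3 / 2 = 1 + 2^-1 :> R by field.
have Q2 : Num.sqrt d%:R ^+ 2 = d%:R :> R by rewrite sqr_sqrtr.
rewrite powRD; last by apply/implyP => /eqP; lra.
by rewrite powRr1// powR12_sqrt// invfM mulrA exprSr Q2; ring.
Qed.

Lemma length_bound_gt0 (d : nat) : (2 <= d)%N -> 0 < length_bound d.
Proof.
move=> d2; have := ln_nat_ge_half d2 => L.
rewrite length_boundE divr_gt0 ?exprn_gt0 ?mulr_gt0 ?sqrtr_gt0 ?ltr0n//.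
- exact: ltnW.
- by lra.
Qed.

(** Lets [d ^ 2] points of radius [2^-1] serve as the fine net. *)
Lemma length_bound_le_sqr (d : nat) : (2 <= d)%N ->
  length_bound d <= 2^-1 *+ (d ^ 2)%N.
Proof.
move=> d2; have L := ln_nat_ge_half d2.
have D2 : 2 <= d%:R :> R by rewrite ler_nat.
rewrite length_boundE -[_ *+ (d ^ 2)%N]mulr_natr natrX.
have S0 : 0 < Num.sqrt (ln d%:R) :> R by rewrite sqrtr_gt0; lra.
have S2 : Num.sqrt (ln d%:R) ^+ 2 = ln d%:R :> R by rewrite sqr_sqrtr//; lra.
have Q2 : Num.sqrt d%:R ^+ 2 = d%:R :> R by rewrite sqr_sqrtr//.
have Q0 := sqrtr_ge0 (d%:R : R).
rewrite -[in leRHS]Q2; set Q := Num.sqrt d%:R in Q2 Q0 *.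
set S := Num.sqrt _ in S0 S2 *.
have Q1 : 1 <= Q by nra.
have S1 : 2^-1 <= S by nra.
rewrite ler_pdivrMr ?mulr_gt0//.
have Q3 : 0 <= Q ^+ 3 by rewrite exprn_ge0.
have -> : 2^-1 * Q ^+ 2 ^+ 2 * (48 * S) = Q ^+ 3 * (24 * (Q * S)) by field.
by rewrite ler_peMr//; nra.
Qed.

(** The union bound over the fine net: each point fails with probability at most [d^-4], for a total
    of at most [d^-2]. *)
Lemma length_bound_tail (d : nat) : (2 <= d)%N ->
  (d ^ 2)%:R * expR (- ((d - d./2)%:R /
    (32 * (length_bound d / d./2%:R) ^+ 2))) < 1 :> R.
Proof.
move=> d2; have L := ln_nat_ge_half d2.
have D2 : 2 <= d%:R :> R by rewrite ler_nat.
set k := d./2; set m := (d - k)%N.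
have kE : (odd d + k.*2 = d)%N by rewrite odd_double_half.
have k0 : (0 < k)%N by rewrite half_gt0.
have K0 : 0 < k%:R :> R by rewrite ltr0n.
have K3 : d%:R <= 3 * k%:R :> R.
  (* The odd case [2 * k + 1 <= 3 * k] needs [1 <= k]. *)
  rewrite -natrM ler_nat -kE; move: k0; case: (odd d); lia.
have m2 : d%:R <= 2 * m%:R :> R.
  by rewrite -natrM ler_nat /m; lia.
have M0 := length_bound_gt0 d2.
set l := _ / k%:R; have l0 : 0 < l by rewrite divr_gt0.
have S0 : 0 < Num.sqrt (ln d%:R) :> R by rewrite sqrtr_gt0; lra.
have S2 : Num.sqrt (ln d%:R) ^+ 2 = ln d%:R :> R by rewrite sqr_sqrtr//; lra.
have Q2 : Num.sqrt d%:R ^+ 2 = d%:R :> R by rewrite sqr_sqrtr//.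
have Q0 : 0 < Num.sqrt d%:R :> R by rewrite sqrtr_gt0; lra.
have lS : l * (16 * Num.sqrt (ln d%:R)) <= Num.sqrt d%:R.
  rewrite /l length_boundE; set Q := Num.sqrt d%:R in Q2 Q0 *.
  set S := Num.sqrt _ in S0 S2 *.
  have -> : Q ^+ 3 / (48 * S) / k%:R * (16 * S) = Q * (Q ^+ 2 / (3 * k%:R)).
    by field; rewrite !gt_eqF.
  by rewrite ler_piMr ?(ltW Q0)// ler_pdivrMr ?mulr_gt0// mul1r Q2.
have lL : l ^+ 2 * (256 * ln d%:R) <= d%:R.
  rewrite -S2 -[leRHS]Q2; have -> : 256 = 16 ^+ 2 :> R by ring.
  rewrite -!exprMn lerXn2r// nnegrE ?mulr_ge0 ?(ltW l0) ?(ltW S0)//; exact: ltW.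
have expo : 4 * ln d%:R <= m%:R / (32 * l ^+ 2).
  have l2 : 0 < 32 * l ^+ 2 by apply: mulr_gt0; rewrite ?exprn_gt0.
  rewrite ler_pdivlMr//.
  have -> : 4 * ln d%:R * (32 * l ^+ 2) = l ^+ 2 * (256 * ln d%:R) / 2 by field.
  by lra.
apply: (@le_lt_trans _ _ ((d ^ 2)%:R * expR (- (4 * ln d%:R)))).
  by rewrite ler_wpM2l// ler_expR lerN2.
rewrite expRN expRM_natl lnK ?posrE; last by lra.
by rewrite ltr_pdivrMr ?exprn_gt0//; [rewrite mul1r natrX ltr_eXn2l//; lra|lra].
Qed.

End Numerics.

Theorem theorem6 (R : realType) :
  exists2 c : R, 0 < c &
    forall d : nat, (2 <= d)%N ->
    forall (a b : R) (P : R -> 'rV[R]_d),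
      a <= b ->
      {within `[a, b], continuous P} ->
      (curve_length a b P < +oo)%E ->
      P a = 0 ->
      (forall q : 'rV[R]_d, unit_sphere R d q ->
         exists2 t : R, t \in `[a, b] & views (P t) q) ->
      ((c * (d%:R `^ (3 / 2) / Num.sqrt (ln d%:R)))%:E
         <= curve_length a b P)%E.
Proof.
exists 48^-1 => // d d2 a b P _ _ _ _ seen.
rewrite leNgt -/(length_bound d); apply/negP => short.
have k0 : (0 < d./2)%N by rewrite half_gt0.
have M0 := @length_bound_gt0 R d d2.
pose l : R := length_bound d / d./2%:R.
have l0 : 0 < l by rewrite divr_gt0// ltr0n.
have [||K [Kk Kab Knet]] := @curve_net R d a b P l d./2.
- by [].
(* The radius [l] is chosen so that [d./2] gaps add up to exactly [length_bound d]. *)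
- by rewrite -mulr_natr divfK// pnatr_eq0 -lt0n.
have [||Y [Yd Yab Ynet]] := @curve_net R d a b P 2^-1 (d ^ 2).
- by [].
- by apply: lt_le_trans short _; rewrite lee_fin length_bound_le_sqr.
have [|||y||q qq1 qY] := @unseen_direction R d (map P K) (map P Y) (d - d./2) l.
- by rewrite subn_gt0; lia.
- by rewrite size_map; lia.
- exact: l0.
- case/mapP => t /Yab tab ->; have [u uK tu] := Knet _ tab.
  by exists (P u) => //; exact: map_f.
- apply: le_lt_trans (length_bound_tail d2).
  by rewrite size_map ler_wpM2r ?expR_ge0// ler_nat.
have [t tab /views_dot_ge1] := seen q ((unit_sphereE q).2 qq1).
have {tab} /Ynet[u uY tu] : a <= t <= b by [].
have yq := qY _ (map_f P uY).
(* Moving from [P u] to [P t] changes the product with [q] by at most 1/4 + 1/4, so it stays below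
   1. *)
have := dot_le_amgm (P t - P u) q.
rewrite dotBl -enorm_sqr qq1.
have : enorm (P t - P u) ^+ 2 <= 2^-1 ^+ 2 by rewrite lerXn2r// nnegrE ?enorm_ge0.
by lra.
Qed.
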